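(* Let $R$ be a commutative noetherian local ring with residue field $k$, $M$ a finitely generated $R$-module and $n\ge 0$ an integer. Consider the following conditions: (1) One has $\xi_R(n,M)=0$. (2) Every morphism $f:M\to Z$ in $\operatorname{mod}R$ with $\operatorname{pd}_RZ\le n$ satisfies $f\otimes_Rk=0$. Then the implication $(1)\Longrightarrow(2)$ always holds. The converse also holds if $M$ is an object of $\mathscr{E}_n(R)$.
   Context: $\operatorname{mod}R$ is the category of finitely generated $R$-modules. $\underline{\operatorname{Hom}}_R(X,Y)$ is the quotient of $\operatorname{Hom}_R(X,Y)$ by the submodule of homomorphisms factoring through a projective module. The syzygy $\Omega M$ is the kernel of a surjection $P_0\to M$ with $P_0$ finitely generated projective; it is unique up to projective summands and defines a functor $\Omega$ on the stable category $\underline{\operatorname{mod}}R$ (objects of $\operatorname{mod}R$, morphisms $\underline{\operatorname{Hom}}_R$); $\Omega^n$ is its $n$-fold iterate. The $n$-th approximated $\xi$-invariant $\xi_R(n,M)$ is the $k$-dimension of the kernel of the composite $\operatorname{Hom}_R(M,k)\to\underline{\operatorname{Hom}}_R(M,k)\xrightarrow{\Omega^n}\underline{\operatorname{Hom}}_R(\Omega^nM,\Omega^nk)$, where the first map is the canonical surjection. $\mathscr{E}_n(R)$ is the subcategory of $\operatorname{mod}R$ of modules $M$ for which there is an exact sequence $0\to X\to M\oplus P\to Y\to 0$ in $\operatorname{mod}R$ with $P$ projective, $\operatorname{pd}_RY\le n$ and $\operatorname{Ext}^i_R(X,R)=0$ for all $1\le i\le n$. *)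

(* Defs.v *)
From HB Require Import structures.
From mathcomp Require Import all_boot all_order all_algebra.
From mathcomp Require Import generic_quotient ring_quotient.
From mathcomp Require Import boolp classical_sets functions.
From mathcomp.multinomials Require Import freeg.

Set Implicit Arguments.
Unset Strict Implicit.
Unset Printing Implicit Defensive.

Import GRing.Theory.

Local Open Scope classical_set_scope.
Local Open Scope quotient_scope.
Local Open Scope ring_scope.

Section Submodules.
Variables (R : comNzRingType) (V : lmodType R).

Definition is_submod (S : set V) : Prop :=
  S 0 /\ forall (a : R) (u v : V), S u -> S v -> S (a *: u + v).

Definition span (A : set V) : {pred V} :=
  fun v => `[< forall S : set V, is_submod S -> A `<=` S -> S v >].

Lemma span_closed A : submod_closed (span A).
Proof.
split=> [|a u v /asboolP uA /asboolP vA]; apply/asboolP => S Ssub AS.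
  by case: Ssub.
by case: (Ssub) => _ SS; apply: SS; [apply: uA|apply: vA].
Qed.
HB.instance Definition _ A :=
  GRing.isSubmodClosed.Build R V (span A) (span_closed A).

Lemma mem_span (A : set V) v : A v -> v \in span A.
Proof. by move=> Av; apply/asboolP => S _; apply. Qed.

End Submodules.

Section QuotientModule.
Variables (R : comNzRingType) (V : lmodType R) (S : submodClosed V).

Definition submod_pred : {pred V} := fun v => v \in S.
Lemma submod_pred_closed : zmod_closed submod_pred.
Proof. exact: (GRing.submod_closedB (submodClosedP S)). Qed.
HB.instance Definition _ := GRing.isZmodClosed.Build V submod_pred submod_pred_closed.

Definition quotmod := Quotient.quot submod_pred.
HB.instance Definition _ := GRing.Zmodule.on quotmod.

Definition qproj (v : V) : quotmod := \pi_(Quotient.quot submod_pred) v.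
Definition qscale (a : R) (q : quotmod) : quotmod := qproj (a *: repr q).

Lemma qproj_eq u v : (qproj u = qproj v) <-> u - v \in S.
Proof.
rewrite -[u - v \in S]/(u - v \in submod_pred) Quotient.idealrBE.
by split=> /eqP.
Qed.

Lemma qproj_repr q : qproj (repr q) = q.
Proof. exact: reprK. Qed.

Lemma qprojB u v : qproj (u - v) = qproj u - qproj v.
Proof. exact: (raddfB (\pi_(Quotient.quot submod_pred))). Qed.
Lemma qprojD u v : qproj (u + v) = qproj u + qproj v.
Proof. exact: (raddfD (\pi_(Quotient.quot submod_pred))). Qed.

Lemma qscaleE a v : qscale a (qproj v) = qproj (a *: v).
Proof.
apply/qproj_eq; rewrite -scalerBr rpredZ//.
by apply/qproj_eq; rewrite qproj_repr.
Qed.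

Lemma qscaleA a b q : qscale a (qscale b q) = qscale (a * b) q.
Proof. by rewrite -(qproj_repr q) !qscaleE scalerA. Qed.
Lemma qscale1 : left_id 1 qscale.
Proof. by move=> q; rewrite -(qproj_repr q) qscaleE scale1r. Qed.
Lemma qscaleDr : right_distributive qscale +%R.
Proof.
move=> a q r; rewrite -(qproj_repr q) -(qproj_repr r).
by rewrite -qprojD !qscaleE -qprojD scalerDr.
Qed.
Lemma qscaleDl q : {morph qscale^~ q : a b / a + b}.
Proof. by move=> a b; rewrite -(qproj_repr q) !qscaleE -qprojD scalerDl. Qed.
HB.instance Definition _ := GRing.Zmodule_isLmodule.Build R quotmod
  qscaleA qscale1 qscaleDr qscaleDl.

Lemma qproj_linear : linear qproj.
Proof. by move=> a u v; rewrite qprojD -qscaleE. Qed.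
HB.instance Definition _ :=
  GRing.isLinear.Build R V quotmod *:%R qproj qproj_linear.

End QuotientModule.
Arguments qproj {R V} S v.

Section KernelModule.
Variables (R : comNzRingType) (U V : lmodType R) (f : {linear U -> V}).

Definition kerpred : {pred U} := fun u => f u == 0.

Lemma kerpred_closed : submod_closed kerpred.
Proof.
split=> [|a u v]; first by rewrite unfold_in /= linear0.
by rewrite !unfold_in /= linearP => /eqP -> /eqP ->; rewrite scaler0 addr0.
Qed.
HB.instance Definition _ := GRing.isSubmodClosed.Build R U kerpred kerpred_closed.

Record kermod := KerMod { kerval :> U; kervalP : kerval \in kerpred }.
HB.instance Definition _ := [isSub for kerval].
HB.instance Definition _ := [Choice of kermod by <:].
HB.instance Definition _ := [SubChoice_isSubLmodule of kermod by <:].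

Lemma kerval_linear : linear kerval.
Proof. by []. Qed.
HB.instance Definition _ :=
  GRing.isLinear.Build R kermod U *:%R kerval kerval_linear.

End KernelModule.

Section HomModule.
Variables (R : comNzRingType) (M N : lmodType R).

Definition islin : {pred M -> N} := fun f => `[< linear f >].

Lemma islin_closed : submod_closed islin.
Proof.
split=> [|a f g /asboolP fl /asboolP gl]; apply/asboolP => b u v /=.
  by rewrite scaler0 addr0.
rewrite !fctE /= fl gl !scalerDr !scalerA (mulrC b a) !addrA; congr (_ + _).
by rewrite addrAC.
Qed.
HB.instance Definition _ := GRing.isSubmodClosed.Build R (M -> N) islin islin_closed.

Definition lin_sub (f : M -> N) (fl : f \in islin) : {linear M -> N} :=
  HB.pack_for {linear M -> N} f (GRing.isLinear.Build R M N *:%R f (asboolW fl)).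

Lemma lin_islin (f : {linear M -> N}) : (f : M -> N) \in islin.
Proof. by apply/asboolP; exact: linearP. Qed.

Lemma lin_ext (f g : {linear M -> N}) : (f : M -> N) = g -> f = g.
Proof.
case: f g => f [[fa] [fs]] [g [[ga] [gs]]] /= e; subst g.
by rewrite (Prop_irrelevance fa ga) (Prop_irrelevance fs gs).
Qed.

Lemma lin_sub_rect (K : {linear M -> N} -> Type) :
  (forall f fl, K (@lin_sub f fl)) -> forall g, K g.
Proof.
move=> Ksub g; have -> : g = lin_sub (lin_islin g) by exact: lin_ext.
exact: Ksub.
Qed.

Lemma lin_subK f fl : @lin_sub f fl = f :> (M -> N).
Proof. by []. Qed.

(* Hom_R(M, N), with pointwise operations, as a submodule of the function space. *)
HB.instance Definition _ := isSub.Build (M -> N) islin {linear M -> N}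
  lin_sub_rect lin_subK.
HB.instance Definition _ := [Choice of {linear M -> N} by <:].
HB.instance Definition _ := [SubChoice_isSubLmodule of {linear M -> N} by <:].

Lemma lin_addE (f g : {linear M -> N}) x : (f + g) x = f x + g x.
Proof. by []. Qed.
Lemma lin_scaleE a (f : {linear M -> N}) x : (a *: f) x = a *: f x.
Proof. by []. Qed.
Lemma lin_0E x : (0 : {linear M -> N}) x = 0.
Proof. by []. Qed.
Lemma lin_oppE (f : {linear M -> N}) x : (- f) x = - f x.
Proof. by []. Qed.
End HomModule.

Section Projective.
Variable R : comNzRingType.
Implicit Types M N P X Y : lmodType R.

Definition is_surj (A B : Type) (f : A -> B) : Prop := forall y, exists x, f x = y.

Definition exact_at X Y (Z : lmodType R) (f : X -> Y) (g : Y -> Z) : Prop :=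
  forall y, g y = 0 <-> exists x, f x = y.

Definition short_exact X Y (Z : lmodType R)
    (f : {linear X -> Y}) (g : {linear Y -> Z}) : Prop :=
  [/\ injective f, exact_at f g & is_surj g].

Definition projective P : Prop :=
  forall (A B : lmodType R) (g : {linear A -> B}) (h : {linear P -> B}),
    is_surj g -> exists l : {linear P -> A}, forall x, g (l x) = h x.

Record proj_resolution M := ProjResolution {
  pr_obj :> nat -> lmodType R;
  pr_d : forall i, {linear pr_obj i.+1 -> pr_obj i};
  pr_aug : {linear pr_obj 0%N -> M};
  pr_proj : forall i, projective (pr_obj i);
  pr_aug_surj : is_surj pr_aug;
  pr_exact0 : exact_at (pr_d 0%N) pr_aug;
  pr_exactS : forall i, exact_at (pr_d i.+1) (pr_d i)
}.

Definition pd_le (n : nat) M : Prop :=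
  exists P : proj_resolution M, forall i, (n < i)%N -> forall x : P i, x = 0.

(* The maps that factor through a projective module; [stHom] is the quotient of
   Hom_R(M, N) by this submodule. *)
Definition factors_proj M N : {pred {linear M -> N}} := fun f =>
  `[< exists (P : lmodType R) (a : {linear M -> P}) (b : {linear P -> N}),
      projective P /\ forall x, f x = b (a x) >].

Lemma projective_triv P : (forall x : P, x = 0) -> projective P.
Proof.
move=> P0 A B g h _; exists 0 => x.
by rewrite (P0 x) !linear0.
Qed.

Lemma projective_prod P Q : projective P -> projective Q ->
  projective (P * Q)%type.
Proof.
move=> pP pQ A B g h gs.
have hlin1 : linear (fun x : P => h (x, 0 : Q)).
  by move=> a u v; rewrite -linearP; congr (h _); congr pair; rewrite /= scaler0 addr0.
have hlin2 : linear (fun x : Q => h (0 : P, x)).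
  by move=> a u v; rewrite -linearP; congr (h _); congr pair; rewrite /= scaler0 addr0.
have [l1 l1E] := pP _ _ g (lin_sub (asboolT hlin1)) gs.
have [l2 l2E] := pQ _ _ g (lin_sub (asboolT hlin2)) gs.
have llin : linear (fun x : P * Q => l1 x.1 + l2 x.2).
  by move=> a u v /=; rewrite (linearP l1) (linearP l2) scalerDr addrACA.
exists (lin_sub (asboolT llin)) => -[x y] /=.
rewrite linearD l1E l2E /= -linearD; congr (h _); congr pair => /=.
  by rewrite addr0.
by rewrite add0r.
Qed.

Lemma factors_proj_closed M N : submod_closed (@factors_proj M N).
Proof.
split=> [|c f g /asboolP[P [a [b [pP fE]]]] /asboolP[Q [a' [b' [pQ gE]]]]];
  apply/asboolP.
  exists 'rV[R]_0, 0, 0; split=> [|x]; last by [].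
  by apply: projective_triv => x; apply/matrixP => i [].
have alin : linear (fun x => (a x, a' x)).
  by move=> e u v; rewrite (linearP a) (linearP a').
have blin : linear (fun x : P * Q => c *: b x.1 + b' x.2).
  move=> e u v /=; rewrite (linearP b) (linearP b') !scalerDr !scalerA (mulrC c e).
  exact: addrACA.
exists (P * Q)%type, (lin_sub (asboolT alin)), (lin_sub (asboolT blin)).
split=> [|x]; first exact: projective_prod.
by rewrite lin_addE lin_scaleE /= fE gE.
Qed.
HB.instance Definition _ M N :=
  GRing.isSubmodClosed.Build R {linear M -> N} (@factors_proj M N)
    (@factors_proj_closed M N).

Definition stHom M N := quotmod (@factors_proj M N).
Definition st_class M N : {linear M -> N} -> stHom M N :=
  qproj (@factors_proj M N).
End Projective.

Section FiniteGeneration.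
Variable R : comNzRingType.
Implicit Types M N : lmodType R.

Definition lincomb M (s : seq M) (c : 'rV[R]_(size s)) : M :=
  \sum_(i < size s) c ord0 i *: s`_i.

Lemma lincomb_linear M (s : seq M) : linear (@lincomb M s).
Proof.
move=> a u v; rewrite /lincomb scaler_sumr -big_split; apply: eq_bigr => i _ /=.
by rewrite !mxE scalerDl scalerA.
Qed.
HB.instance Definition _ M (s : seq M) :=
  GRing.isLinear.Build R 'rV[R]_(size s) M *:%R (@lincomb M s) (@lincomb_linear M s).

Definition generates M (s : seq M) (S : set M) : Prop :=
  forall x, S x <-> exists c, lincomb (s := s) c = x.

Definition fin_gen M : Prop := exists s : seq M, generates s setT.

Definition noetherian : Prop :=
  forall I : set R^o, is_submod I -> exists s : seq R^o, generates s I.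

Definition maximal_ideal (m : set R) : Prop :=
  [/\ is_submod (m : set R^o), ~ m 1 &
    forall J : set R, is_submod (J : set R^o) -> ~ J 1 -> m `<=` J -> J = m].

(* (R, m) is local: m is the one and only maximal ideal. *)
Definition local_ring (m : set R) : Prop :=
  forall m' : set R, maximal_ideal m' <-> m' = m.

(* p exhibits k as R / m. *)
Definition residue_map (m : set R) (k : fieldType) (p : {rmorphism R -> k}) : Prop :=
  is_surj p /\ forall x, p x = 0 <-> m x.

End FiniteGeneration.

Section Syzygy.
Variable R : comNzRingType.
Implicit Types M N X : lmodType R.

(* A chosen finite generating sequence; [::] if M is not finitely generated.
   Over a noetherian ring the default never occurs in what follows, since all
   the iterated syzygies of a finitely generated module are finitely generated
   (fin_gen_Omegan). *)
Definition gens M : seq M := xget [::] [set s : seq M | generates s setT].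
Definition cover_obj M : lmodType R := 'rV[R]_(size (gens M)).
Definition cover M : {linear cover_obj M -> M} := lincomb (s := gens M).

Lemma cover_surj M : fin_gen M -> is_surj (@cover M).
Proof. by move=> /(xgetPex [::]) gM x; apply/(gM x). Qed.

(* The kernel of the chosen surjection from a finitely generated free module. *)
Definition Omega M : lmodType R := kermod (cover M).
Definition Omega_incl M : {linear Omega M -> cover_obj M} := @kerval _ _ _ (cover M).

(* g is the restriction to the syzygies of a lift F of f to the free covers. *)
Definition syzygy_of M N (f : {linear M -> N}) (g : {linear Omega M -> Omega N}) :
    Prop :=
  exists F : {linear cover_obj M -> cover_obj N},
    (forall x, cover N (F x) = f (cover M x)) /\
    (forall z, Omega_incl N (g z) = F (Omega_incl M z)).

Definition Omega_map M N (f : {linear M -> N}) : {linear Omega M -> Omega N} :=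
  xget 0 [set g | syzygy_of f g].

Lemma projective_rV n : projective 'rV[R]_n.
Proof.
move=> A B g h gs.
have /boolp.choice[a aE] : forall i, exists x : A, g x = h (delta_mx 0 i).
  by move=> i; exact: gs.
have llin : linear (fun x : 'rV[R]_n => \sum_i x 0 i *: a i).
  move=> e u v; rewrite scaler_sumr -big_split; apply: eq_bigr => i _ /=.
  by rewrite !mxE scalerDl scalerA.
exists (lin_sub (asboolT llin)) => x /=.
rewrite [in RHS](row_sum_delta x) !linear_sum; apply: eq_bigr => i _.
by rewrite !linearZ /= aE.
Qed.

Lemma ker_lift M N (h : {linear M -> cover_obj N}) :
  (forall x, cover N (h x) = 0) ->
  exists g : {linear M -> Omega N}, forall x, Omega_incl N (g x) = h x.
Proof.
move=> h0.
have hker x : h x \in kerpred (cover N) by apply/eqP; exact: h0.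
have glin : linear (fun x => KerMod (hker x) : Omega N).
  by move=> a u v; apply: val_inj; rewrite /= linearP.
by exists (lin_sub (asboolT glin)).
Qed.

Lemma Omega_mapP M N (f : {linear M -> N}) :
  fin_gen N -> syzygy_of f (Omega_map f).
Proof.
move=> fgN; apply: (@xgetPex _ 0 [set g | syzygy_of f g]).
have [F FE] := projective_rV (f \o cover M) (cover_surj fgN).
have /ker_lift[g gE] : forall z, cover N ((F \o Omega_incl M) z) = 0.
  by move=> z; rewrite /= FE /= (eqP (kervalP z)) linear0.
by exists g, F.
Qed.

Lemma syzygy_of_stable M N (f f' : {linear M -> N}) g g' : fin_gen N ->
  syzygy_of f g -> syzygy_of f' g' -> st_class f = st_class f' ->
  st_class g = st_class g'.
Proof.
move=> fgN [F [FE gE]] [F' [FE' gE']] /qproj_eq/asboolP[P [a [b [pP abE]]]].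
have [l lE] := pP _ _ (cover N) b (cover_surj fgN).
have /ker_lift[d dE] : forall x, cover N ((F - F' - (l \o a \o cover M)) x) = 0.
  move=> x; rewrite !lin_addE !lin_oppE /= !linearD !linearN /= FE FE' lE -abE.
  by rewrite lin_addE lin_oppE subrr.
apply/qproj_eq/asboolP; exists (cover_obj M), (Omega_incl M), d.
split=> [|z]; first exact: projective_rV.
apply: val_inj; rewrite /= -[RHS]/(Omega_incl N (d (Omega_incl M z))) dE.
rewrite !lin_addE !lin_oppE /= (eqP (kervalP z)) !linear0 addr0.
by rewrite -gE -gE'.
Qed.

(* Independent of the representative of c and of the choice of the lift:
   see Omega_stE. *)
Definition Omega_st M N (c : stHom M N) : stHom (Omega M) (Omega N) :=
  st_class (Omega_map (repr c)).

Lemma Omega_stE M N (f : {linear M -> N}) g : fin_gen N -> syzygy_of f g ->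
  Omega_st (st_class f) = st_class g.
Proof.
move=> fgN fg; apply: (syzygy_of_stable fgN (Omega_mapP _ fgN) fg).
exact: qproj_repr.
Qed.

Fixpoint Omegan (n : nat) M : lmodType R :=
  if n is n'.+1 then Omega (Omegan n' M) else M.

Fixpoint Omegan_st (n : nat) M N : stHom M N -> stHom (Omegan n M) (Omegan n N) :=
  if n is n'.+1 then fun c => Omega_st (Omegan_st n' c) else fun c => c.

End Syzygy.

Section Noetherian.
Variables (R : comNzRingType) (noethR : noetherian R).

Lemma lincombP (M : lmodType R) (s : seq M) x :
  (exists c, lincomb (s := s) c = x) <->
  (exists c : nat -> R, \sum_(i < size s) c i *: s`_i = x).
Proof.
split=> [[c <-]|[c <-]].
  exists (fun i => if insub i is Some j then c 0 j else 0).
  by apply: eq_bigr => i _; rewrite valK.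
by exists (\row_i c i); apply: eq_bigr => i _; rewrite mxE.
Qed.

Lemma fin_gen_submod_rV n j (S : set 'rV[R]_n) : is_submod S ->
    (forall x (i : 'I_n), S x -> (j <= i)%N -> x 0 i = 0) ->
  exists s : seq 'rV[R]_n, generates s S.
Proof.
elim: j S => [|j IHj] S Ssub Sj.
  exists [::] => x; split=> [Sx|[c <-]].
    exists 0; rewrite /lincomb big_ord0; apply/rowP => i.
    by rewrite mxE (Sj x i).
  by rewrite /lincomb big_ord0; case: Ssub.
have [jn|nj] := ltnP j n; last first.
  apply: IHj => // x i _ ji; have := leq_ltn_trans (leq_trans nj ji) (ltn_ord i).
  by rewrite ltnn.
pose j0 := Ordinal jn; have [S0 SS] := Ssub.
have SZ a u : S u -> S (a *: u) by move=> Su; rewrite -[a *: u]addr0; exact: SS.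
have SB u v : S u -> S v -> S (u - v).
  by move=> Su Sv; rewrite addrC -scaleN1r; exact: SS.
pose S' := [set x | S x /\ x 0 j0 = 0].
have [s sS'] : exists s : seq 'rV[R]_n, generates s S'.
  apply: IHj => [|x i [Sx x0]].
    split=> [|a u v [Su u0] [Sv v0]]; first by split; rewrite ?mxE.
    by split; [exact: SS|rewrite !mxE u0 v0 mulr0 addr0].
  by rewrite leq_eqVlt => /predU1P[/esym ij|]; [rewrite (_ : i = j0)//; exact: val_inj|exact: Sj].
pose I : set R^o := [set a | exists2 x, S x & x 0 j0 = a].
have [t tI] : exists t : seq R^o, generates t I.
  apply: noethR; split=> [|a _ _ [u Su <-] [v Sv <-]].
    by exists 0 => //; rewrite mxE.
  by exists (a *: u + v); [exact: SS|rewrite !mxE].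
have /boolp.choice[l lP] : forall i : nat, exists x : 'rV[R]_n, S x /\ ((i < size t)%N -> x 0 j0 = t`_i).
  move=> i; have [it|ti] := ltnP i (size t); last by exists 0.
  suff [x Sx xt] : I t`_i by exists x.
  apply/tI/lincombP; exists (fun k => (k == i)%:R).
  rewrite (bigD1 (Ordinal it)) //= eqxx scale1r big1 ?addr0// => k.
  by rewrite -val_eqE /= => /negPf ->; rewrite scale0r.
have Ssum (r : seq 'rV[R]_n) (c : nat -> R) m : (forall i, (i < m)%N -> S r`_i) ->
    S (\sum_(i < m) c i *: r`_i).
  move=> rS; elim/big_ind: _ => // [u v Su Sv|i _]; last by apply: SZ; exact: rS.
  by rewrite -[u]scale1r; exact: SS.
have sS i : (i < size s)%N -> S s`_i.
  move=> si; suff [] : S' s`_i by [].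
  apply/sS'/lincombP; exists (fun k => (k == i)%:R).
  rewrite (bigD1 (Ordinal si)) //= eqxx scale1r big1 ?addr0// => k.
  by rewrite -val_eqE /= => /negPf ->; rewrite scale0r.
exists (s ++ mkseq l (size t)) => x; split=> [Sx|/lincombP[c <-]].
  have /tI/lincombP[d dE] : I (x 0 j0) by exists x.
  pose y := \sum_(i < size t) d i *: l i.
  have Sy : S y.
    rewrite /y (eq_bigr (fun i : 'I_(size t) => d i *: (mkseq l (size t))`_i)).
      by apply: Ssum => i it; rewrite nth_mkseq//; case: (lP i).
    by move=> i _; rewrite nth_mkseq.
  have /sS'/lincombP[c cE] : S' (x - y).
    split; first exact: SB.
    rewrite !mxE summxE -dE -sumrB big1// => i _; rewrite mxE.
    by case: (lP i) => _ ->//; rewrite subrr.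
  apply/lincombP; exists (fun i => if (i < size s)%N then c i else d (i - size s)%N).
  rewrite size_cat size_mkseq big_split_ord /= -[RHS](subrK y) -cE; congr (_ + _).
    by apply: eq_bigr => i _; rewrite nth_cat ltn_ord.
  apply: eq_bigr => i _.
  by rewrite nth_cat ltnNge leq_addr /= addKn nth_mkseq.
apply: Ssum => i; rewrite nth_cat size_cat size_mkseq; case: (ltnP i (size s)) => [si _|si].
  exact: sS.
by rewrite -ltn_subLR // => it; rewrite nth_mkseq//; case: (lP (i - size s)%N).
Qed.

Lemma fin_gen_Omega (M : lmodType R) : fin_gen (Omega M).
Proof.
have [s sP] : exists s, generates s [set x | cover M x = 0].
  apply: (@fin_gen_submod_rV _ (size (gens M))) => [|x i _].
    by split=> [|a u v /= u0 v0]; rewrite /= ?linear0// lincomb_linear u0 v0 scaler0 addr0.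
  by rewrite leqNgt ltn_ord.
have sK i : (i < size s)%N -> s`_i \in kerpred (cover M).
  move=> si; apply/eqP; apply/(sP s`_i)/lincombP; exists (fun k => (k == i)%:R).
  rewrite (bigD1 (Ordinal si)) //= eqxx scale1r big1 ?addr0// => k.
  by rewrite -val_eqE /= => /negPf ->; rewrite scale0r.
exists [seq insubd (0 : Omega M) x | x <- s] => z; split=> // _.
have /sP/lincombP[c cE] : cover M (Omega_incl M z) = 0 by apply/eqP; exact: kervalP.
apply/lincombP; exists c; apply: val_inj.
rewrite /= -[RHS]cE size_map -[LHS]/(Omega_incl M _) linear_sum.
apply: eq_bigr => i _; rewrite linearZ /= (nth_map 0)//; congr (_ *: _).
by rewrite val_insubd sK.
Qed.

Lemma fin_gen_Omegan n (M : lmodType R) : fin_gen M -> fin_gen (Omegan n M).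
Proof. by case: n => [//|n _]; exact: fin_gen_Omega. Qed.

End Noetherian.

Section Ext.
Variable R : comNzRingType.
Implicit Types M N X : lmodType R.

Definition precomp (A B N : lmodType R) (d : {linear A -> B}) :
    {linear B -> N} -> {linear A -> N} := fun h => h \o d.
Arguments precomp {A B} N d.

Lemma precomp_linear (A B N : lmodType R) (d : {linear A -> B}) : linear (precomp N d : {linear B -> N} -> {linear A -> N}).
Proof. by move=> a u v; apply: lin_ext. Qed.
HB.instance Definition _ (A B N : lmodType R) (d : {linear A -> B}) := GRing.isLinear.Build R _ _ *:%R
  (precomp N d) (@precomp_linear A B N d).

(* The free resolution ... -> res_obj X 1 -> res_obj X 0 -> X glued from the
   covers of the iterated syzygies of X. *)
Definition res_obj X (i : nat) : lmodType R := cover_obj (Omegan i X).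
Definition res_d X (i : nat) : {linear res_obj X i.+1 -> res_obj X i} :=
  Omega_incl (Omegan i X) \o cover (Omegan i.+1 X).

Definition cocycle (i : nat) X N : lmodType R := kermod (precomp N (res_d X i)).

Definition coboundary (i : nat) X N : {pred cocycle i X N} :=
  match i return {pred cocycle i X N} with
  | 0 => fun z => z == 0
  | j.+1 => fun z => `[< exists h : {linear res_obj X j -> N},
                          precomp N (res_d X j) h = kerval z >]
  end.

Lemma coboundary_closed i X N : submod_closed (@coboundary i X N).
Proof.
case: i => [|i]; split.
- exact: eqxx.
- by move=> a u v /eqP -> /eqP ->; rewrite scaler0 addr0; exact: eqxx.
- by apply/asboolP; exists 0; rewrite linear0.
move=> a u v /asboolP[h hu] /asboolP[h' hv]; apply/asboolP.
by exists (a *: h + h'); rewrite precomp_linear hu hv.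
Qed.
HB.instance Definition _ i X N := GRing.isSubmodClosed.Build R (cocycle i X N)
  (@coboundary i X N) (@coboundary_closed i X N).

(* The i-th cohomology of Hom_R(res_obj X, N). *)
Definition Ext (i : nat) X N : lmodType R := quotmod (@coboundary i X N).

(* Membership in the subcategory E_n(R), for a finitely generated M. *)
Definition in_E (n : nat) M : Prop :=
  exists (X P Y : lmodType R) (f : {linear X -> (M * P)%type})
         (g : {linear (M * P)%type -> Y}),
    [/\ fin_gen X, fin_gen P & fin_gen Y] /\
    [/\ projective P, short_exact f g, pd_le n Y &
        forall i, (1 <= i <= n)%N -> forall e : Ext i X R^o, e = 0].
End Ext.

Section Tensor.
Variable R : comNzRingType.
Implicit Types M N : lmodType R.

Definition tensor_rel M N : set {freeg (M * N) / R} := [set t |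
  (exists a x x' y, t = << (a *: x + x', y) >> - (a *: << (x, y) >> + << (x', y) >>))
  \/
  (exists a x y y', t = << (x, a *: y + y') >> - (a *: << (x, y) >> + << (x, y') >>))].

(* M (x)_R N: the free module on M * N modulo the bilinearity relations. *)
Definition tensor M N : lmodType R := quotmod (span (@tensor_rel M N)).
Definition pure M N (x : M) (y : N) : tensor M N :=
  qproj (span (@tensor_rel M N)) << (x, y) >>.

Lemma fglift_linear (K : choiceType) M (f : K -> M) : linear (@fglift R M K f).
Proof.
pose F := HB.pack_for {additive {freeg K / R} -> M} (@fglift R M K f)
  (GRing.isZmodMorphism.Build _ _ _ (lift_is_additive f)).
move=> a u v; rewrite -[LHS]/(F _) raddfD; congr (_ + _).
have -> : a *: u = \sum_(x <- dom u) << a * coeff x u *g x >> by [].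
have FE : F u = \sum_(x <- dom u) coeff x u *: f x.
  rewrite -{1}(freeg_sumE u) raddf_sum; apply: eq_bigr => x _; exact: liftU.
rewrite -[fglift f u]/(F u) FE scaler_sumr raddf_sum; apply: eq_bigr => x _.
by rewrite scalerA; exact: liftU.
Qed.
HB.instance Definition _ (K : choiceType) M (f : K -> M) :=
  GRing.isLinear.Build R {freeg K / R} M *:%R (@fglift R M K f) (fglift_linear f).

Definition free_map M M' N (f : {linear M -> M'}) :
    {linear {freeg (M * N) / R} -> {freeg (M' * N) / R}} :=
  fglift (fun z : M * N => << (f z.1, z.2) >> : {freeg (M' * N) / R}).

Lemma free_mapU M M' N (f : {linear M -> M'}) x (y : N) :
  free_map N f << (x, y) >> = << (f x, y) >>.
Proof. by rewrite /= liftU scale1r. Qed.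

Lemma free_map_rel M M' N (f : {linear M -> M'}) t :
  t \in span (@tensor_rel M N) -> free_map N f t \in span (@tensor_rel M' N).
Proof.
move=> /asboolP st.
apply: (st [set t | free_map N f t \in span (@tensor_rel M' N)]); first split.
- by rewrite /= linear0 rpred0.
- by move=> a u v /= us vs; rewrite (linearP (free_map N f)) rpredD// rpredZ.
- move=> _ [[a [x [x' [y ->]]]]|[a [x [y [y' ->]]]]] /=;
    apply: mem_span; [left; exists a, (f x), (f x'), y|right; exists a, (f x), y, y'];
    rewrite -/(free_map N f _) linearB linearD linearZ !free_mapU //.
  by rewrite linearP.
Qed.

Definition tensor_fun M M' N (f : {linear M -> M'}) (t : tensor M N) : tensor M' N :=
  qproj (span (@tensor_rel M' N)) (free_map N f (repr t)).

Lemma tensor_funE M M' N (f : {linear M -> M'}) t :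
  tensor_fun f (qproj (span (@tensor_rel M N)) t) =
  qproj (span (@tensor_rel M' N)) (free_map N f t).
Proof.
apply/qproj_eq; rewrite -linearB; apply: free_map_rel.
by apply/qproj_eq; exact: qproj_repr.
Qed.

Lemma tensor_fun_linear M M' N (f : {linear M -> M'}) :
  linear (@tensor_fun M M' N f).
Proof.
move=> a u v; rewrite -(qproj_repr u) -(qproj_repr v) -linearP !tensor_funE.
by rewrite -linearP -linearP.
Qed.
HB.instance Definition _ M M' N (f : {linear M -> M'}) :=
  GRing.isLinear.Build R (tensor M N) (tensor M' N) *:%R
    (@tensor_fun M M' N f) (@tensor_fun_linear M M' N f).

Definition tensor_map M M' N (f : {linear M -> M'}) :
  {linear tensor M N -> tensor M' N} := @tensor_fun M M' N f.

Lemma tensor_map_pure M M' N (f : {linear M -> M'}) x (y : N) :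
  tensor_map N f (pure x y) = pure (f x) y.
Proof. by rewrite /= tensor_funE free_mapU. Qed.
End Tensor.

(* k as an R-module, through p: an alias that carries p, so that the module
   structure can be inferred. *)
Definition resmod (R : comNzRingType) (k : fieldType) (p : {rmorphism R -> k}) :
  Type := k.

Section Xi.
Variables (R : comNzRingType) (k : fieldType) (p : {rmorphism R -> k}).
Local Notation resmod := (resmod p).

HB.instance Definition _ := GRing.Zmodule.copy resmod k.
Definition res_scale (a : R) (x : resmod) : resmod := p a * (x : k).
Lemma res_scaleA a b x : res_scale a (res_scale b x) = res_scale (a * b) x.
Proof. by rewrite /res_scale rmorphM mulrA. Qed.
Lemma res_scale1 : left_id 1 res_scale.
Proof. by move=> x; rewrite /res_scale rmorph1 mul1r. Qed.
Lemma res_scaleDr : right_distributive res_scale +%R.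
Proof. by move=> a x y; rewrite /res_scale -mulrDr. Qed.
Lemma res_scaleDl x : {morph res_scale^~ x : a b / a + b}.
Proof. by move=> a b; rewrite /res_scale rmorphD mulrDl. Qed.
HB.instance Definition _ := GRing.Zmodule_isLmodule.Build R resmod
  res_scaleA res_scale1 res_scaleDr res_scaleDl.

Definition lin_indep (V : lmodType k) d (b : 'I_d -> V) : Prop :=
  forall c : 'I_d -> k, \sum_(i < d) c i *: b i = 0 -> forall i, c i = 0.

Definition has_dim (V : lmodType k) (W : set V) (d : nat) : Prop :=
  exists b : 'I_d -> V,
    [/\ forall i, W (b i),
        lin_indep b &
        forall w, W w -> exists c : 'I_d -> k, w = \sum_(i < d) c i *: b i].

(* Hom_R(M, k) -> stHom(M, k) -> stHom(Omega^n M, Omega^n k). *)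
Definition xi_map n (M : lmodType R) (f : {linear M -> resmod}) :
  stHom (Omegan n M) (Omegan n resmod) := Omegan_st n (st_class f).

(* The kernel of xi_map, seen in the k-space of all functions M -> k; its k-space
   structure is the pointwise one. *)
Definition xi_ker n (M : lmodType R) : set (M -> k^o) :=
  [set h | exists2 f : {linear M -> resmod}, (f : M -> k) = h & xi_map n f = 0].

Arguments xi_ker n M : clear implicits.

Lemma lin_indep_hom (M : lmodType R) (s : seq M) d (b : 'I_d -> M -> k^o) :
  generates s setT -> (forall i, exists f : {linear M -> resmod}, (f : M -> k) = b i) ->
  lin_indep b -> (d <= size s)%N.
Proof.
move=> gs bl bi; rewrite leqNgt; apply/negP => ltsd.
pose A : 'M[k]_(d, size s) := \matrix_(i, j) b i s`_j.
have : kermx A != 0.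
  rewrite -mxrank_eq0 mxrank_ker -lt0n subn_gt0.
  exact: leq_ltn_trans (rank_leq_col A) ltsd.
case/rowV0Pn => c /sub_kermxP cA; apply/negP; rewrite negbK; apply/eqP/rowP => i.
rewrite mxE; apply: (bi (c 0)); apply/funext => x.
have /(_ x)[/(_ I)[r <-] _] := gs.
rewrite fct_sumE.
transitivity (\sum_(j < size s) p (r 0 j) * (c *m A) 0 j); last first.
  by apply: big1 => j _; rewrite cA mxE mulr0.
under [RHS]eq_bigr => j _ do rewrite mxE mulr_sumr.
rewrite exchange_big; apply: eq_bigr => {}i _ /=.
have [f fE] := bl i.
rewrite -fE !fctE linear_sum [LHS]mulr_sumr; apply: eq_bigr => j _.
by rewrite linearZ /= mxE -fE /GRing.scale /= mulrCA.
Qed.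

Lemma xi_ker_dim n (M : lmodType R) : fin_gen M -> exists d, has_dim (xi_ker n M) d.
Proof.
move=> [s gs]; set W := xi_ker n M.
pose P d := `[< exists b : 'I_d -> M -> k^o, (forall i, W (b i)) /\ lin_indep b >].
have P0 : exists d, P d.
  by exists 0%N; apply/asboolP; exists (fun _ => 0); split=> [[]//|c _ []].
have Pmax d : P d -> (d <= size s)%N.
  move=> /asboolP[b [bW bi]]; apply: (lin_indep_hom gs _ bi) => i.
  by have [f fE _] := bW i; exists f.
case: (ex_maxnP P0 Pmax) => d /asboolP[b [bW bi]] dmax.
exists d, b; split=> // w wW; apply: contrapT => wb.
have /dmax : P d.+1; last by rewrite ltnn.
apply/asboolP; exists (fun i => if unlift ord0 i is Some j then b j else w).
split=> [i|c]; first by case: unliftP.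
rewrite big_ord_recl unlift_none; under eq_bigr do rewrite liftK.
have [c0|c0] := eqVneq (c ord0) 0.
  rewrite c0 scale0r add0r => /bi cS i.
  by case: (unliftP ord0 i) => [j ->|->//]; exact: (cS j).
move=> /eqP; rewrite addr_eq0 => /eqP cw; exfalso; apply: wb.
exists (fun j => - (c ord0)^-1 * c (fintype.lift ord0 j)).
under eq_bigr do rewrite -scalerA scaleNr.
by rewrite sumrN -scaler_sumr -scalerN -cw scalerA mulVf// scale1r.
Qed.

(* The default 0 is never taken when M is finitely generated: see xiP. *)
Definition xi n (M : lmodType R) : nat := xget 0%N [set d | has_dim (xi_ker n M) d].

Lemma xiP n (M : lmodType R) : fin_gen M -> has_dim (xi_ker n M) (xi n M).
Proof. by move=> fgM; have /(xgetPex 0%N) := xi_ker_dim n fgM. Qed.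

End Xi.
Arguments xi {R k} p n M.
Arguments xi_ker {R k} p n M.
Arguments xi_map {R k} p n {M} f.

(* Main.v *)
Require Import Defs.
From mathcomp Require Import all_boot all_order all_algebra.
From mathcomp Require Import boolp classical_sets functions.
From mathcomp.multinomials Require Import freeg.
Import Defs GRing.Theory.

Set Implicit Arguments.
Unset Strict Implicit.
Unset Printing Implicit Defensive.

Local Open Scope classical_set_scope.
Local Open Scope ring_scope.

(** Everything is read off linear forms with values in [k].  Two translations
    are used: [xi p n M = 0] means that a map [f : M -> k] with
    [Omega^n f = 0] in the stable category is zero ([xi_eq0]), and, for a
    finitely generated [Z], a map [f : M -> Z] satisfies [f (x) k = 0] if and
    only if [g o f = 0] for every [g : Z -> k] ([tensor_map_res0P]).

    For the first implication, let [f : M -> Z] with [pd Z <= n] and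
    [g : Z -> k].  The identity of [Omega^n Z] factors through a projective
    module ([pd_le_id_stable0]), hence so does
    [Omega^n (g o f) = Omega^n g o Omega^n f], and [g o f = 0].

    For the second one, take [0 -> X -> M + P -> Y -> 0] as in the definition
    of [in_E] and [f : M -> k] with [Omega^n f = 0] stably.  The composite
    [X -> M -> k] is killed by [Omega^n] too, and [Ext^i(X, R) = 0] for
    [1 <= i <= n] makes [Omega^n] injective on stable homomorphisms out of [X]
    ([Omegan_stable_inj]); so [X -> k] factors through a finite free module
    [F].  The pushout [Z] of [M + P <- X -> F] is an extension of [Y] by [F],
    so [pd Z <= n] ([pd_le_ext]), and [f] factors as [M -> Z -> k]
    ([factor_pushout]).  As [M -> Z] vanishes after tensoring with [k], [f] is
    zero. *)

(** * Linear maps, quotients and finite generation *)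

Section Basics.
Variable R : comNzRingType.
Implicit Types M N U V W : lmodType R.

(** Bundling of a function proved linear. *)
Lemma linP U V (f : U -> V) : linear f ->
  exists g : {linear U -> V}, forall x, g x = f x.
Proof. by move=> fl; exists (lin_sub (asboolT fl)). Qed.

Lemma mem_span_submod V (A : set V) v : is_submod A -> v \in span A -> A v.
Proof. by move=> As /asboolP; apply. Qed.

(** A linear map vanishing on [S] descends to the quotient by [S]. *)
Lemma quotmod_lift V W (S : submodClosed V) (h : {linear V -> W}) :
  (forall v, v \in S -> h v = 0) ->
  exists g : {linear quotmod S -> W}, forall v, g (qproj S v) = h v.
Proof.
move=> h0.
have hE v : h (repr (qproj S v)) = h v.
  apply/eqP; rewrite -subr_eq0 -linearB; apply/eqP/h0.
  by apply/qproj_eq; exact: qproj_repr.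
have [|g gE] := @linP (quotmod S) W (fun q => h (repr q)).
  move=> a u v; rewrite -[u in LHS]qproj_repr -[v in LHS]qproj_repr -linearP hE.
  by rewrite linearP.
by exists g => v; rewrite gE hE.
Qed.

Lemma fin_genP M : fin_gen M <->
  exists n (e : {linear 'rV[R]_n -> M}), is_surj e.
Proof.
split=> [[s gs]|[n [e es]]].
  by exists (size s), (lincomb (s := s)) => x; apply/(gs x).
exists [seq e (delta_mx 0 i) | i <- enum 'I_n] => x; split=> // _.
have [c <-] := es x; apply/lincombP.
exists (fun i => if insub i is Some j then c 0 j else 0).
rewrite size_map size_enum_ord [in RHS](row_sum_delta c) linear_sum.
apply: eq_bigr => i _; rewrite valK linearZ (nth_map i) ?size_enum_ord//.
by rewrite nth_ord_enum.
Qed.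

Lemma fin_gen_surj M N (f : {linear M -> N}) : is_surj f -> fin_gen M -> fin_gen N.
Proof.
move=> fs /fin_genP[n [e es]]; apply/fin_genP; exists n, (f \o e) => y.
by have [x <-] := fs y; have [c <-] := es x; exists c.
Qed.

Lemma fin_gen_prod M N : fin_gen M -> fin_gen N -> fin_gen (M * N)%type.
Proof.
move=> /fin_genP[n [e es]] /fin_genP[n' [e' es']]; apply/fin_genP.
have [|h hE] := @linP 'rV[R]_(n + n') (M * N)%type
    (fun c => (e (lsubmx c), e' (rsubmx c))).
  by move=> a u v; rewrite !linearP.
exists (n + n')%N, h => -[x y]; have [c <-] := es x; have [c' <-] := es' y.
by exists (row_mx c c'); rewrite hE row_mxKl row_mxKr.
Qed.

End Basics.

(** * Syzygies in the stable category *)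

Section StableSyzygy.
Variable R : comNzRingType.
Implicit Types K M N X Y Z : lmodType R.

Lemma st_class0P M N (f : {linear M -> N}) : st_class f = 0 <->
  exists (P : lmodType R) (a : {linear M -> P}) (b : {linear P -> N}),
    projective P /\ forall x, f x = b (a x).
Proof.
rewrite -[0](linear0 (qproj (@factors_proj R M N))); split=> [/qproj_eq|H].
  by rewrite subr0 => /asboolP.
by apply/qproj_eq; rewrite subr0; apply/asboolP.
Qed.

Lemma syzygy_of_comp M N Z (f : {linear M -> N}) (g : {linear N -> Z}) f' g' :
  syzygy_of f f' -> syzygy_of g g' -> syzygy_of (g \o f) (g' \o f').
Proof.
move=> [F [FE f'E]] [G [GE g'E]]; exists (G \o F); split=> x /=.
  by rewrite GE FE.
by rewrite g'E f'E.
Qed.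

(** The iterated syzygy of a homomorphism; it represents [Omegan_st]. *)
Fixpoint Omegan_map n {M N} (f : {linear M -> N}) :
    {linear Omegan n M -> Omegan n N} :=
  if n is n'.+1 then Omega_map (Omegan_map n' f) else f.

Hypothesis noethR : noetherian R.

Lemma Omegan_stE n M N (f : {linear M -> N}) : fin_gen N ->
  Omegan_st n (st_class f) = st_class (Omegan_map n f).
Proof.
move=> fgN; elim: n => //= n ->.
have fgn := fin_gen_Omegan noethR n fgN.
exact: Omega_stE fgn (Omega_mapP _ fgn).
Qed.

Lemma Omegan_map_comp n M N Z (f : {linear M -> N}) (g : {linear N -> Z}) :
  fin_gen N -> fin_gen Z ->
  st_class (Omegan_map n (g \o f)) = st_class (Omegan_map n g \o Omegan_map n f).
Proof.
move=> fgN fgZ; elim: n => //= n IH.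
have fgNn := fin_gen_Omegan noethR n fgN.
have fgZn := fin_gen_Omegan noethR n fgZ.
apply: (syzygy_of_stable fgZn (Omega_mapP _ fgZn) _ IH).
by apply: syzygy_of_comp; exact: Omega_mapP.
Qed.

(** Comparison of the chosen free resolution of [Z] with a given projective
    resolution [Q]: the [n]-th syzygy of [Z] is, in the stable category, a
    retract of the cokernel [K] of [Q_(n+1) -> Q_n]. *)
Lemma resolution_retract Z (Q : proj_resolution Z) n : fin_gen Z ->
  exists (K : lmodType R) (e : {linear Q n -> K})
      (a : {linear Omegan n Z -> K}) (b : {linear K -> Omegan n Z}),
    [/\ is_surj e, exact_at (pr_d Q n) e & st_class (b \o a) = st_class idfun].
Proof.
move=> fgZ; elim: n => [|n [K [e [a [b [es ex ab]]]]]].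
  exists Z, (pr_aug Q), idfun, idfun; split.
  - exact: pr_aug_surj.
  - exact: pr_exact0.
  - by congr st_class; exact: lin_ext.
have fgn := fin_gen_Omegan noethR n fgZ.
have [F FE] := @projective_rV R _ _ _ e (a \o cover (Omegan n Z)) es.
have [G GE] := @pr_proj _ _ Q n _ _ (cover (Omegan n Z)) (b \o e) (cover_surj fgn).
(* F and G restrict to the kernels of the two surjections. *)
have Fker (z : Omega (Omegan n Z)) : F (Omega_incl _ z) \in kerpred e.
  by apply/eqP; rewrite FE /= (eqP (kervalP z)) linear0.
have [|a' a'E] := @linP _ _ (kermod e) (fun z => KerMod (Fker z)).
  by move=> c u v; apply: val_inj; rewrite /= !linearP.
have [|b' b'E] := @ker_lift R (kermod e) _ (G \o @kerval _ _ _ e).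
  by move=> z; rewrite /= GE /= (eqP (kervalP z)) linear0.
have dker x : pr_d Q n x \in kerpred e by apply/eqP/ex; exists x.
have [|d dE] := @linP _ _ (kermod e) (fun x => KerMod (dker x)).
  by move=> c u v; apply: val_inj; rewrite /= !linearP.
exists (kermod e), d, a', b'; split.
- move=> z; have /ex[x xE] : e (kerval z) = 0 := eqP (kervalP z).
  by exists x; rewrite dE; apply: val_inj.
- move=> y; rewrite dE -(pr_exactS y); split=> [/(congr1 val)//|y0].
  exact: val_inj.
- apply: (syzygy_of_stable fgn _ _ ab); last by exists idfun.
  exists (G \o F); split=> x /=; first by rewrite GE /= FE.
  by rewrite b'E /= a'E.
Qed.

(** The [n]-th syzygy of a module of projective dimension at most [n] is
    projective; only the vanishing of its stable identity is needed. *)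
Lemma pd_le_id_stable0 n Z : fin_gen Z -> pd_le n Z ->
  st_class (idfun : {linear Omegan n Z -> Omegan n Z}) = 0.
Proof.
move=> fgZ [Q Q0]; have [K [e [a [b [es ex <-]]]]] := resolution_retract Q n fgZ.
apply/st_class0P; exists K, a, b; split=> // A B g h gs.
have [l lE] := @pr_proj _ _ Q n _ _ g (h \o e) gs.
(* As Q_(n+1) = 0, the surjection e : Q_n -> K is injective. *)
have e0 x : e x = 0 -> x = 0.
  by move=> /ex[y <-]; rewrite (Q0 n.+1 (ltnSn n) y) linear0.
have /boolp.choice[s sE] := es.
have sl : linear (l \o s).
  move=> c u v /=; rewrite -linearP; congr (l _).
  apply/eqP; rewrite -subr_eq0; apply/eqP/e0.
  by rewrite linearB linearP !sE subrr.
by have [l' l'E] := linP sl; exists l' => x; rewrite l'E lE /= sE.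
Qed.

(** A linear form on the [j+1]-st syzygy of [X] is a cocycle after composition
    with the free cover, and extends to the [j]-th free module of the
    resolution exactly when that cocycle is a coboundary. *)
Lemma ext_extend X j (u : {linear Omegan j.+1 X -> R^o}) : fin_gen X ->
  (forall e : Ext j.+1 X R^o, e = 0) ->
  exists v : {linear res_obj X j -> R^o},
    forall z, v (Omega_incl (Omegan j X) z) = u z.
Proof.
move=> fgX E0.
pose w : {linear res_obj X j.+1 -> R^o} := u \o cover (Omegan j.+1 X).
have zP : w \in kerpred (@precomp R _ _ R^o (res_d X j.+1)).
  apply/eqP; apply: lin_ext; apply/funext => x /=.
  by rewrite /precomp /= (eqP (kervalP (cover _ x))) linear0.
pose z : cocycle j.+1 X R^o := KerMod zP.
have : z \in @coboundary R j.+1 X R^o.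
  have := E0 (qproj (@coboundary R j.+1 X R^o) z).
  rewrite -[RHS](linear0 (qproj (@coboundary R j.+1 X R^o))) => /qproj_eq.
  by rewrite subr0.
move=> /asboolP[v vE]; exists v => y.
have [x <-] := cover_surj (fin_gen_Omegan noethR j.+1 fgX) y.
by have := congr1 (fun h : {linear _ -> _} => h x) vE.
Qed.

Lemma ext_extend_rV X j r (u : {linear Omegan j.+1 X -> 'rV[R]_r}) : fin_gen X ->
  (forall e : Ext j.+1 X R^o, e = 0) ->
  exists v : {linear res_obj X j -> 'rV[R]_r},
    forall z, v (Omega_incl (Omegan j X) z) = u z.
Proof.
move=> fgX E0.
have /boolp.choice[v vE] : forall i : 'I_r, exists v : {linear res_obj X j -> R^o},
    forall z, v (Omega_incl (Omegan j X) z) = u z 0 i.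
  move=> i.
  have [|ui uiE] := @linP _ _ R^o (fun z => u z 0 i).
    by move=> c x y; rewrite linearP !mxE.
  by have [v vE] := ext_extend ui fgX E0; exists v => z; rewrite vE uiE.
have [|w wE] := @linP _ (res_obj X j) 'rV[R]_r (fun x => \row_i v i x).
  by move=> c x y; apply/rowP => i; rewrite !mxE linearP.
by exists w => z; rewrite wE; apply/rowP => i; rewrite mxE vE.
Qed.

(** When [Ext^(j+1)(X, R) = 0], the syzygy functor is injective on stable
    homomorphisms out of the [j]-th syzygy of [X]. *)
Lemma Omega_stable_inj X N j (f : {linear Omegan j X -> N}) :
  fin_gen X -> fin_gen N -> (forall e : Ext j.+1 X R^o, e = 0) ->
  st_class (Omega_map f) = 0 -> st_class f = 0.
Proof.
move=> fgX fgN E0 /st_class0P[P [a [b [pP abE]]]].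
have [F [FE gE]] := Omega_mapP f fgN.
have [l lE] := pP _ _ (cover (Omega N)) b (cover_surj (fin_gen_Omega noethR N)).
have [v vE] := ext_extend_rV (l \o a) fgX E0.
(* The corrected lift G of f vanishes on the syzygy, so it descends to a map
   from the j-th syzygy to the free cover of N, through which f factors. *)
pose G : {linear res_obj X j -> cover_obj N} :=
  F - (Omega_incl N \o cover (Omega N) \o v).
have GE x : G x = F x - Omega_incl N (cover (Omega N) (v x)) by [].
have G0 x : cover (Omegan j X) x = 0 -> G x = 0.
  move=> x0; have xK : x \in kerpred (cover (Omegan j X)) by apply/eqP.
  have := vE (KerMod xK); have := gE (KerMod xK); rewrite GE /= => <- ->.
  by rewrite abE /= lE subrr.
have /boolp.choice[s sE] := cover_surj (fin_gen_Omegan noethR j fgX).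
have [|h hE] := @linP _ _ (cover_obj N) (fun y => G (s y)).
  move=> c y y'; apply/eqP; rewrite -linearP -subr_eq0 -linearB; apply/eqP/G0.
  by rewrite linearB linearP !sE subrr.
apply/st_class0P; exists (cover_obj N), h, (cover N).
split=> [|x]; first exact: projective_rV.
rewrite hE GE linearB FE sE.
by rewrite (eqP (kervalP (cover (Omega N) (v (s x))))) subr0.
Qed.

Lemma Omegan_stable_inj X N n (f : {linear X -> N}) :
  fin_gen X -> fin_gen N ->
  (forall i, (1 <= i <= n)%N -> forall e : Ext i X R^o, e = 0) ->
  st_class (Omegan_map n f) = 0 -> st_class f = 0.
Proof.
move=> fgX fgN; elim: n => //= n IH E0 f0; apply: IH.
  by move=> i /andP[i1 i_n]; apply: E0; rewrite i1 leqW.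
apply: Omega_stable_inj f0 => //; first exact: fin_gen_Omegan.
by apply: E0; rewrite leqnn.
Qed.

(** An extension of a module of projective dimension at most [n] by a
    projective module has projective dimension at most [n]: a resolution [Q]
    of [Y] becomes one of [Z] when [Q 0] is replaced by [Q 0 * F]. *)
Lemma pd_le_ext n (F Z Y : lmodType R)
    (i : {linear F -> Z}) (q : {linear Z -> Y}) :
  projective F -> short_exact i q -> pd_le n Y -> pd_le n Z.
Proof.
move=> pF [ii ex qs] [Q Q0].
have i0 x : i x = 0 -> x = 0 by rewrite -(linear0 i) => /ii.
have [l lE] := @pr_proj _ _ Q 0%N _ _ q (pr_aug Q) qs.
have aug_d x : pr_aug Q (pr_d Q 0 x) = 0 by apply/pr_exact0; exists x.
(* c corrects the composite of l with the differential, which lands in F. *)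
have /boolp.choice[c cE] : forall x, exists y, i y = - l (pr_d Q 0 x).
  by move=> x; apply/ex; rewrite linearN lE aug_d oppr0.
pose obj j : lmodType R := if j is j'.+1 then Q j'.+1 else (Q 0%N * F)%type.
have [|d0 d0E] := @linP _ (Q 1%N) (Q 0%N * F)%type (fun x => (pr_d Q 0 x, c x)).
  move=> a u v; rewrite linearP; congr pair; apply: ii.
  by rewrite [RHS](linearP i) !cE scalerN -opprD -linearP -linearP.
pose d j : {linear obj j.+1 -> obj j} :=
  if j is j'.+1 then pr_d Q j'.+1 else d0.
have [|aug augE] := @linP _ (Q 0%N * F)%type Z (fun x => l x.1 + i x.2).
  by move=> a u v; rewrite /= !linearP scalerDr addrACA.
have objP j : projective (obj j).
  by case: j => [|j]; [apply: projective_prod => //; exact: pr_proj|exact: pr_proj].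
have augS : is_surj aug.
  move=> z; have [x xE] := pr_aug_surj Q (q z).
  have [|y yE] := (ex (z - l x)).1; first by rewrite linearB lE xE subrr.
  by exists (x, y); rewrite augE /= yE addrC subrK.
have ex0 : exact_at (d 0%N) aug.
  move=> [x y]; rewrite augE; split=> [/= xy0|[w]]; last first.
    by rewrite /= d0E => -[<- <-]; rewrite /= cE subrr.
  have : pr_aug Q x = 0.
    have /(congr1 q) := xy0; rewrite linearD lE linear0.
    by rewrite (ex (i y)).2 ?addr0//; exists y.
  move=> /pr_exact0[w wE]; exists w; rewrite d0E wE; congr pair.
  by apply: ii; rewrite cE wE; apply/esym/eqP; rewrite -addr_eq0 addrC xy0.
have exS j : exact_at (d j.+1) (d j).
  case: j => [|j]; last exact: pr_exactS.
  move=> y; rewrite -[d 1%N]/(pr_d Q 1) -(pr_exactS y) /= d0E.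
  split=> [[]//|y0]; rewrite y0; congr pair; apply: i0.
  by rewrite cE y0 linear0 oppr0.
exists (ProjResolution objP augS ex0 exS) => -[//|j] nj x.
exact: Q0 nj x.
Qed.

(** A map [f : M -> N] whose restriction to [X] factors through a finite free
    module [F] factors through the pushout of [M <- X -> F], an extension of
    [Y] by [F]. *)
Lemma factor_pushout n X M Y N r (i : {linear X -> M}) (q : {linear M -> Y})
    (a : {linear X -> 'rV[R]_r}) (b : {linear 'rV[R]_r -> N})
    (f : {linear M -> N}) :
  short_exact i q -> fin_gen M -> pd_le n Y -> (forall x, f (i x) = b (a x)) ->
  exists (Z : lmodType R) (g : {linear M -> Z}) (h : {linear Z -> N}),
    [/\ fin_gen Z, pd_le n Z & forall x, h (g x) = f x].
Proof.
move=> [ii ex qs] fgM pdY fE.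
pose A : set (M * 'rV[R]_r)%type := [set z | exists x, z = (i x, - a x)].
have Asub : is_submod A.
  split=> [|c u v [x ->] [y ->]]; first by exists 0; rewrite !linear0.
  by exists (c *: x + y); rewrite (linearP i) (linearP a) opprD -scalerN.
pose Z := quotmod (span A).
have qE u v : qproj (span A) u = qproj (span A) v <-> A (u - v).
  split=> [/qproj_eq|Auv]; first exact: mem_span_submod.
  by apply/qproj_eq; exact: mem_span.
have [|g gE] := @linP _ M Z (fun x => qproj (span A) (x, 0)).
  move=> c u v; rewrite -linearP; congr (qproj _ _); congr pair.
  by rewrite /= scaler0 addr0.
have [|j jE] := @linP _ 'rV[R]_r Z (fun y => qproj (span A) (0, y)).
  move=> c u v; rewrite -linearP; congr (qproj _ _); congr pair.
  by rewrite /= scaler0 addr0.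
have [|h0 h0E] := @linP _ (M * 'rV[R]_r)%type N (fun z => f z.1 + b z.2).
  by move=> c u v; rewrite /= !linearP scalerDr addrACA.
have [|h hE] := @quotmod_lift _ _ _ (span A) h0.
  move=> v /(mem_span_submod Asub)[x ->].
  by rewrite h0E /= fE linearN subrr.
have [|q0 q0E] := @linP _ (M * 'rV[R]_r)%type Y (fun z => q z.1).
  by move=> c u v; rewrite /= linearP.
have qi x : q (i x) = 0 by apply/ex; exists x.
have [|q' q'E] := @quotmod_lift _ _ _ (span A) q0.
  by move=> v /(mem_span_submod Asub)[x ->]; rewrite q0E /= qi.
have i0 x : i x = 0 -> x = 0 by rewrite -(linear0 i) => /ii.
(* The pushout Z sits in 0 -> F -> Z -> Y -> 0. *)
have jq' : short_exact j q'.
  split.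
  - move=> y y'; rewrite !jE => /qE[x [/esym]]; rewrite subr0 => /i0 -> /eqP.
    by rewrite linear0 oppr0 subr_eq0 => /eqP.
  - move=> z; split=> [|[y <-]]; last by rewrite jE q'E q0E linear0.
    rewrite -(qproj_repr z); case: (repr z) => u v; rewrite q'E q0E /= => /ex[x xE].
    exists (v + a x); rewrite jE; apply/qE; exists (- x); congr pair => /=.
      by rewrite sub0r linearN xE.
    by rewrite linearN opprK addrAC subrr add0r.
  - move=> y; have [x <-] := qs y; exists (g x).
    by rewrite gE q'E q0E.
exists Z, g, h; split.
- apply: (@fin_gen_surj _ _ _ (qproj (span A))).
    by move=> z; exists (repr z); exact: qproj_repr.
  apply: fin_gen_prod => //; apply/fin_genP; exists r, idfun => x.
  by exists x.
- exact: pd_le_ext (@projective_rV R r) jq' pdY.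
- by move=> x; rewrite gE hE h0E /= linear0 addr0.
Qed.

End StableSyzygy.

(** * Linear forms with values in the residue field *)

Section ResidueTensor.
Variables (R : comNzRingType) (k : fieldType) (p : {rmorphism R -> k}).
Hypothesis p_surj : is_surj p.
Implicit Types M N Z V : lmodType R.
Local Notation res := (resmod p).
Local Notation onek := ((1 : k) : resmod p).

Lemma resmod_fin_gen : fin_gen res.
Proof.
apply/fin_genP; have [|e eE] := @linP _ 'rV[R]_1 res (fun c => p (c 0 0)).
  by move=> a u v; rewrite !mxE rmorphD rmorphM.
exists 1%N, e => y; have [r <-] := p_surj y.
by exists (const_mx r); rewrite eE mxE.
Qed.

Lemma pureDl M N a (x x' : M) (y : N) :
  pure (a *: x + x') y = a *: pure x y + pure x' y.
Proof.
rewrite -linearP; apply/qproj_eq; apply: mem_span.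
by left; exists a, x, x', y.
Qed.

Lemma pureDr M N a (x : M) (y y' : N) :
  pure x (a *: y + y') = a *: pure x y + pure x y'.
Proof.
rewrite -linearP; apply/qproj_eq; apply: mem_span.
by right; exists a, x, y, y'.
Qed.

Lemma pure0l M N (y : N) : pure (0 : M) y = 0.
Proof. by have := @pureDl M N (-1) 0 0 y; rewrite scaler0 addr0 scaleN1r addNr. Qed.

Lemma pure0r M N (x : M) : pure x (0 : N) = 0.
Proof. by have := @pureDr M N (-1) x 0 0; rewrite scaler0 addr0 scaleN1r addNr. Qed.

(** [k] is cyclic as an [R]-module, so every tensor is pure. *)
Lemma tensor_res_pure Z (t : tensor Z res) :
  exists z : Z, t = pure z onek.
Proof.
rewrite -(qproj_repr t) -(freeg_sumE (repr t)) linear_sum.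
elim/big_ind: _ => [|_ _ [u ->] [v ->]|[x y] _].
- by exists 0; rewrite pure0l.
- by exists (u + v); rewrite -[u]scale1r pureDl !scale1r.
have [r rE] := p_surj y.
exists ((coeff (x, y) (repr t) * r) *: x).
have -> : << coeff (x, y) (repr t) *g (x, y) >> =
    coeff (x, y) (repr t) *: << (x, y) >> :> {freeg (Z * res) / R}.
  by apply/eqP/freeg_eqP => w; rewrite coeffZ !coeffU mul1r.
rewrite linearZ /= -[qproj _ _]/(pure x y); move: (coeff _ _) => c.
have -> : y = r *: onek + 0 :> res.
  by rewrite addr0 /GRing.scale /= /res_scale mulr1 rE.
by rewrite pureDr pure0r !addr0 scalerA -[_ *: x]addr0 pureDl pure0l addr0.
Qed.

(** A finitely generated module annihilated by the kernel of [p] is a finite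
    dimensional vector space, so linear forms separate its points; the forms
    are the coordinates in a generating family of least size. *)
Lemma residue_separated V (v : V) : fin_gen V ->
  (forall r (w : V), p r = 0 -> r *: w = 0) ->
  (forall g : {linear V -> res}, g v = 0) -> v = 0.
Proof.
move=> fgV V0 gv.
pose P d := `[< exists t : 'I_d -> V, forall w, exists c : 'I_d -> R,
  w = \sum_i c i *: t i >].
have P0 : exists d, P d.
  have [s gs] := fgV; exists (size s); apply/asboolP; exists (fun i => s`_i) => w.
  by have [/(_ I)[c <-] _] := gs w; exists (c 0).
case: (ex_minnP P0) => d /asboolP[t tP] dmin.
have tfree c : \sum_i c i *: t i = 0 -> forall i, p (c i) = 0.
  move=> c0 i; apply: contrapT => /eqP ci0.
  case: d t tP dmin c c0 i ci0 => [|d] t tP dmin c c0 i ci0; first by case: i ci0.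
  (* c i acts invertibly, with inverse r, so t i is redundant. *)
  have [r rE] := p_surj (p (c i))^-1.
  have /dmin : P d; last by rewrite ltnn.
  apply/asboolP; exists (fun j => t (fintype.lift i j)) => w.
  have ti : t i = \sum_j (- r * c (fintype.lift i j)) *: t (fintype.lift i j).
    have : (1 - r * c i) *: t i = 0.
      by apply: V0; rewrite rmorphB rmorph1 rmorphM rE mulVf ?subrr.
    move=> /eqP; rewrite scalerBl scale1r subr_eq0 => /eqP ->.
    move: c0; rewrite (bigD1_ord i) //= => /eqP; rewrite addr_eq0 => /eqP c0.
    rewrite -scalerA c0 scalerN scaler_sumr -sumrN; apply: eq_bigr => j _.
    by rewrite mulNr scaleNr scalerA.
  have [e ->] := tP w; rewrite (bigD1_ord i) //= ti.
  exists (fun j => e i * (- r * c (fintype.lift i j)) + e (fintype.lift i j)).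
  rewrite scaler_sumr -big_split; apply: eq_bigr => j _.
  by rewrite /= scalerDl scalerA.
have /boolp.choice[c cE] := tP.
have cP i : linear (fun w => p (c w i) : res).
  move=> a u w; apply/eqP; rewrite -subr_eq0; apply/eqP.
  rewrite -[RHS](tfree (fun i => c (a *: u + w) i - (a * c u i + c w i))  _ i).
    by rewrite rmorphB rmorphD rmorphM.
  under eq_bigr do rewrite scalerBl scalerDl -scalerA.
  by rewrite sumrB big_split /= -scaler_sumr -!cE subrr.
rewrite (cE v) big1// => i _; apply: V0.
by have [g gE] := linP (cP i); rewrite -(gE v).
Qed.

Lemma tensor_map_res0P M Z (f : {linear M -> Z}) : fin_gen Z ->
  tensor_map res f = 0 <-> forall (g : {linear Z -> res}) x, g (f x) = 0.
Proof.
have oneL N : linear (fun z : N => pure z onek : tensor N res).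
  by move=> a u v; exact: pureDl.
move=> fgZ; split=> [f0 g x|gf0].
  (* h is g (x) k followed by the multiplication of k. *)
  have [h hE] : exists h : {linear tensor Z res -> res},
      forall z (y : res), h (pure z y) = (y : k) * (g z : k).
    have [h0 h0E] : exists h0 : {linear {freeg (Z * res) / R} -> res},
        forall z (y : res), h0 << (z, y) >> = (y : k) * (g z : k).
      exists (fglift (fun z : Z * res => ((z.2 : k) * (g z.1 : k) : res))) => z y.
      by rewrite /= liftU scale1r.
    have [t /asboolP tS|h hE] := @quotmod_lift _ _ _ (span (@tensor_rel _ Z res)) h0.
      apply: (tS [set t | h0 t = 0]); first split=> [|a u v /= u0 v0] /=.
      - by rewrite linear0.
      - by rewrite linearP u0 v0 scaler0 addr0.
      - move=> _ [[a [z [z' [y ->]]]]|[a [z [y [y' ->]]]]] /=;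
          rewrite linearB linearP !h0E.
          rewrite linearP /GRing.scale /= /res_scale.
          by rewrite mulrDr mulrCA subrr.
        rewrite /GRing.scale /= /res_scale.
        by rewrite mulrDl mulrA subrr.
    by exists h => z y; rewrite hE h0E.
  have := tensor_map_pure f x onek; rewrite f0 lin_0E => /esym/(congr1 h).
  by rewrite hE linear0 mul1r.
apply: lin_ext; apply/funext => t; have [x ->] := tensor_res_pure t.
rewrite tensor_map_pure lin_0E.
have [j jE] := linP (oneL Z).
apply: residue_separated => [|r w r0|g].
- apply: (@fin_gen_surj _ _ _ j) => // u; have [z ->] := tensor_res_pure u.
  by exists z; rewrite jE.
- have [z ->] := tensor_res_pure w.
  rewrite -[LHS]addr0 -[X in _ + X](pure0r _ z) -pureDr addr0.
  by rewrite /GRing.scale /= /res_scale r0 mul0r pure0r.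
- by rewrite -jE; exact: (gf0 (g \o j)).
Qed.

Lemma xi_eq0 n M : fin_gen M -> xi p n M = 0%N <->
  forall f : {linear M -> res}, xi_map p n f = 0 -> forall x, f x = 0.
Proof.
move=> fgM; have [b [bW bi bs]] := xiP p n fgM.
split=> [d0 f f0 x|H].
  have [|c cE] := bs (f : M -> k); first by exists f.
  have -> : f x = (\sum_i c i *: b i) x by rewrite -cE.
  rewrite fct_sumE big1// => i _.
  by have := ltn_ord i; rewrite [X in (_ < X)%N]d0.
apply/eqP; rewrite -leqn0 leqNgt; apply/negP => d_gt0.
pose i := Ordinal d_gt0; have [f fE /H f0] := bW i.
have bi0 : b i = 0 by rewrite -fE; apply/funext.
have s0 : \sum_j (j == i)%:R *: b j = 0.
  rewrite (bigD1 i) //= bi0 scaler0 add0r big1// => j /negPf ->.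
  by rewrite scale0r.
by have /eqP := bi _ s0 i; rewrite eqxx oner_eq0.
Qed.

End ResidueTensor.

Theorem theorem4p16 (R : comNzRingType) (m : set R) (k : fieldType)
    (p : {rmorphism R -> k}) (n : nat) (M : lmodType R) :
  noetherian R -> local_ring m -> residue_map m p -> fin_gen M ->
  (xi p n M = 0%N ->
   forall (Z : lmodType R) (f : {linear M -> Z}), fin_gen Z -> pd_le n Z ->
     tensor_map (resmod p) f = 0) /\
  (in_E n M ->
   (forall (Z : lmodType R) (f : {linear M -> Z}), fin_gen Z -> pd_le n Z ->
      tensor_map (resmod p) f = 0) ->
   xi p n M = 0%N).
Proof.
move=> noethR _ [ps _] fgM; have fgk := resmod_fin_gen ps; split.
  move=> /(xi_eq0 p n fgM) xi0 Z f fgZ pdZ; apply/(tensor_map_res0P ps f fgZ) => g x.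
  apply: (xi0 (g \o f)); rewrite /xi_map Omegan_stE//.
  rewrite (Omegan_map_comp noethR n f g)//.
  have /st_class0P[P [a [b [pP E]]]] := pd_le_id_stable0 noethR fgZ pdZ.
  apply/st_class0P; exists P, (a \o Omegan_map n f), (Omegan_map n g \o b).
  by split=> // y /=; rewrite -E.
move=> [X [P [Y [i [q [[fgX fgP fgY] [pP exq pdY E0]]]]]]] H.
apply/(xi_eq0 p n fgM) => f; rewrite /xi_map Omegan_stE// => f0 x.
have [|fst1 fst1E] := @linP _ (M * P)%type M fst; first by [].
have : st_class (f \o (fst1 \o i)) = 0.
  apply: (Omegan_stable_inj noethR fgX fgk E0).
  rewrite Omegan_map_comp//.
  move: f0 => /st_class0P[Q [a [b [pQ E]]]].
  apply/st_class0P; exists Q, (a \o Omegan_map n (fst1 \o i)), b.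
  by split=> // y /=; rewrite -E.
move=> /st_class0P[Q [a [b [pQ E]]]].
(* Q may be replaced by the finite free cover of k, which is onto. *)
have [l lE] := pQ _ _ (cover (resmod p)) b (cover_surj fgk).
have fgMP := fin_gen_prod fgM fgP.
have [|Z [g [h [fgZ pdZ hE]]]] := @factor_pushout R n X _ Y _ _ i q (l \o a)
    (cover (resmod p)) (f \o fst1) exq fgMP pdY.
  by move=> y; rewrite /= lE -E.
have [|in1 in1E] := @linP _ M (M * P)%type (fun u => (u, 0)).
  by move=> c u v; congr pair; rewrite /= scaler0 addr0.
have /(tensor_map_res0P ps (g \o in1) fgZ) := H _ (g \o in1) fgZ pdZ.
by move=> /(_ h x) /=; rewrite hE /= fst1E in1E.
Qed.
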